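(* Let $E$ be a finite set, $S=\mathbb{C}[x_e : e\in E]$, and let $I\subset S$ be an ideal that is homogeneous with respect to the standard grading and does not contain the irrelevant ideal $\langle x_e : e\in E\rangle$. Let $w\in\mathbb{R}^E$, let $\Theta=\operatorname{subd}_w\mathcal A(I)$, and let $$I_w=\sum_{\Delta \text{ cell of }\Theta}\widetilde I_\Delta,$$ where $\widetilde I_\Delta$ is the ideal of $S$ generated by $I_\Delta=\rho_\Delta(I)\subset\mathbb{C}[\Delta]\subset S$. Then $I_w\subseteq \operatorname{in}_w I$.
   Context: For $w\in\mathbb{R}^E$, the $w$-weight of the monomial $\prod x_e^{\alpha_e}$ is $\sum_e w_e\alpha_e$. For a nonzero $p\in S$, $\operatorname{in}_w p$ is the sum of the terms of $p$ of minimal $w$-weight, and $\operatorname{in}_w I$ is the ideal generated by all $\operatorname{in}_w p$ with $p\in I\setminus\{0\}$. $\mathcal L(I)=\{w\in\mathbb{R}^E:\operatorname{in}_w I=I\}$ is a linear subspace containing $(1,\dots,1)$. $\mathcal A(I)=(a_e)_{e\in E}$ is the $E$-labeled point configuration in the dual space $\mathcal L(I)^*$, where $a_e$ is the restriction to $\mathcal L(I)$ of the $e$-th coordinate functional. For an $E$-labeled point configuration $A=(a_e)_{e\in E}$ in a real vector space $V$ and $w\in\mathbb{R}^E$, the regular subdivision $\operatorname{subd}_w A$ is the set of subconfigurations $(a_e)_{e\in E_f}$, for $f\in V^*$, where $E_f$ is the set of labels $e$ minimizing $f(a_e)+w_e$. Its elements are called cells, and we write $a_e\in\Delta$ if $e$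 is a label of $\Delta$. For a cell $\Delta$, $\mathbb{C}[\Delta]=\mathbb{C}[x_e: a_e\in\Delta]\subset S$, and $\rho_\Delta:S\to\mathbb{C}[\Delta]$ fixes $x_e$ for $a_e\in\Delta$ and sends all other variables to $0$. *)

(* Defs.v *)
From HB Require Import structures.
From mathcomp Require Import all_boot all_order all_algebra.
From mathcomp Require Import boolp classical_sets reals.
From mathcomp Require Import complex mpoly.

Set Implicit Arguments.
Unset Strict Implicit.
Unset Printing Implicit Defensive.

Import Order.TTheory GRing.Theory Num.Theory.
Local Open Scope classical_set_scope.
Local Open Scope ring_scope.

Section Ideals.
Variable A : comNzRingType.

(* Not [idealr_closed]: ideals are sets here and need not be proper. *)
Definition is_ideal (I : set A) : Prop :=
  [/\ I 0, forall p q, I p -> I q -> I (p + q) & forall r p, I p -> I (r * p)].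

Definition ideal_gen (G : set A) : set A := smallest is_ideal G.

Definition ideal_sum (T : finType) (Theta : set T) (J : T -> set A) : set A :=
  [set p | exists2 g : T -> A,
     forall D, Theta D -> J D (g D) & p = \sum_(D in Theta) g D].

Lemma ideal_gen_ideal G : is_ideal (ideal_gen G).
Proof.
split=> [J [[]]//|p q Gp Gq J JG|r p Gp J JG].
- by have [[_ JD _] _] := JG; apply: JD; [apply: Gp|apply: Gq].
- by have [[_ _ JM] _] := JG; apply: JM; apply: Gp.
Qed.

Lemma is_idealN I : is_ideal I -> forall p, I p -> I (- p).
Proof. by case=> _ _ IM p /(IM (-1)); rewrite mulN1r. Qed.

Lemma is_idealB I : is_ideal I -> forall p q, I p -> I q -> I (p - q).
Proof.
by move=> II p q Ip /(is_idealN II); case: II => _ ID _; apply: ID.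
Qed.

End Ideals.

Section Vspace.
Variables (K : fieldType) (V : vectType K).

(* P as a subspace if it is one (see vspace_ofP), and 0 otherwise. *)
Definition vspace_of (P : set V) : {vspace V} :=
  xget 0%VS [set U : {vspace V} | [set v | v \in U] = P].

Lemma vspace_ofP (P : set V) :
  P 0 -> (forall a u v, P u -> P v -> P (a *: u + v)) ->
  forall v, v \in vspace_of P <-> P v.
Proof.
move=> P0 Plin.
suff [U PU] : exists U : {vspace V}, [set v | v \in U] = P.
  move=> v; rewrite /vspace_of; case: xgetP => [W _ /= <-//|/(_ U)].
  by move=> /(_ PU).
have key k : (exists U : {vspace V},
    [set v | v \in U] `<=` P /\ (\dim {:V} <= \dim U + k)%N) ->
    exists U : {vspace V}, [set v | v \in U] = P.
  elim: k => [|k IHk] [U [UP dU]].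
    exists U; apply/seteqP; split=> // v _ /=.
    suff -> : U = fullv by exact: memvf.
    by apply/eqP; rewrite eqEdim subvf -(addn0 (\dim U)).
  have [PU|/existsNP[v /not_implyP[Pv vU]]] := pselect (P `<=` [set v | v \in U]).
    by exists U; apply/seteqP.
  apply: IHk; exists (U + <[v]>)%VS; split.
    move=> _ /= /memv_addP[u uU [_ /vlineP[a ->] ->]].
    by rewrite addrC; apply: Plin; [exact: Pv|exact: (UP _ uU)].
  have /= ? : (\dim U < \dim (U + <[v]>))%N.
    rewrite ltnNge; apply/negP => le; apply: vU => /=.
    have /eqP -> : U == (U + <[v]>)%VS by rewrite eqEdim addvSl.
    by move: (memv_add (mem0v U) (memv_line v)); rewrite add0r.
  by apply: leq_trans dU _; rewrite addnS -addSn leq_add2r.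
apply: (key (\dim {:V})); exists 0%VS; split; last by rewrite leq_addl.
by move=> v /=; rewrite memv0 => /eqP ->.
Qed.

End Vspace.

(* The variable x_e of C[x_e : e in E] is 'X_(enum_rank e). *)
Notation polyring R E := {mpoly (complex R)[#|E|]}.
Notation "''R^' ( R , E )" := {ffun E -> R^o} (format "''R^' ( R ,  E )").

Section Initial.
Variables (R : realType) (E : finType).
Local Notation S := (polyring R E).
Implicit Types (w : 'R^(R, E)) (p q : S) (I : set S).

Definition weight w (m : 'X_{1..#|E|}) : R :=
  \sum_e w e * (m (enum_rank e))%:R.

Definition initial_form w p : S :=
  \sum_(m <- msupp p | all (fun m' => weight w m <= weight w m') (msupp p))
    p@_m *: 'X_[m].

Definition initial_ideal w I : set S :=
  ideal_gen [set initial_form w p | p in I `\ 0].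

Definition homogeneous_ideal I : Prop :=
  forall p d, I p -> I (pihomog mdeg d p).

Definition irrelevant_ideal : set S :=
  ideal_gen [set 'X_(enum_rank e) | e in [set: E]].

Definition lineality I : set 'R^(R, E) := [set w | initial_ideal w I = I].

(* lineality I is a linear subspace by mem_lineality_space below. *)
Definition lineality_space I : {vspace 'R^(R, E)} := vspace_of (lineality I).

Definition trunc (Q : pred 'X_{1..#|E|}) p : S :=
  \sum_(m <- msupp p | Q m) p@_m *: 'X_[m].

Lemma mcoeff_trunc Q p m : (trunc Q p)@_m = if Q m then p@_m else 0.
Proof.
rewrite raddf_sum /=.
under eq_bigr => k _ do rewrite mcoeffZ mcoeffX.
have [mp|mp] := boolP (m \in msupp p); last first.
  rewrite (memN_msupp_eq0 mp) if_same big1_seq// => k /andP[_ kp].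
  case: eqP => [km|_]; last by rewrite mulr0.
  by rewrite km (negbTE mp) in kp.
rewrite big_mkcond (bigD1_seq m) ?msupp_uniq//= eqxx mulr1 big1 ?addr0//.
by move=> k /negbTE ->; rewrite mulr0 if_same.
Qed.

Lemma truncB Q p q : trunc Q (p - q) = trunc Q p - trunc Q q.
Proof.
apply/mpolyP=> m; rewrite mcoeffB !mcoeff_trunc mcoeffB.
by case: ifP; rewrite ?subr0.
Qed.

Lemma trunc_id (Q : pred _) p : (forall m, m \in msupp p -> Q m) -> trunc Q p = p.
Proof.
move=> pQ; apply/mpolyP=> m; rewrite mcoeff_trunc; case: ifPn => // nQ.
by rewrite memN_msupp_eq0//; apply: contra nQ; exact: pQ.
Qed.

Lemma trunc_eq0 (Q : pred _) p : (forall m, m \in msupp p -> ~~ Q m) -> trunc Q p = 0.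
Proof.
move=> pQ; apply/mpolyP=> m; rewrite mcoeff_trunc mcoeff0; case: ifPn => // nQ.
by rewrite memN_msupp_eq0//; apply/negP => /pQ; rewrite nQ.
Qed.

Lemma mem_trunc (Q : pred _) p m : (m \in msupp (trunc Q p)) = Q m && (m \in msupp p).
Proof. by rewrite !mcoeff_msupp mcoeff_trunc; case: (Q m); rewrite ?eqxx. Qed.

Lemma size_trunc (Q : pred _) p m : m \in msupp p -> Q m ->
  (size (msupp (p - trunc Q p)) < size (msupp p))%N.
Proof.
move=> mp Qm; rewrite ltnNge; apply/negP => le.
have sub : {subset msupp (p - trunc Q p) <= msupp p}.
  move=> k; rewrite !mcoeff_msupp mcoeffB mcoeff_trunc.
  by case: ifP; rewrite ?subrr ?eqxx ?subr0.
have [_ /(_ m)] := uniq_min_size (msupp_uniq _) sub le.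
by rewrite mp mcoeff_msupp mcoeffB mcoeff_trunc Qm subrr eqxx.
Qed.

Definition level w c p : S := trunc (fun m => weight w m == c) p.

Lemma size_level w p m : m \in msupp p ->
  (size (msupp (p - level w (weight w m) p)) < size (msupp p))%N.
Proof. by move=> mp; apply: (size_trunc mp); exact: eqxx. Qed.

Lemma msupp_nil p : p != 0 -> exists m, m \in msupp p.
Proof.
move=> p0; exists (mlead p); exact: mlead_supp.
Qed.

Lemma exists_min w p : p != 0 -> exists2 m, m \in msupp p &
  forall m', m' \in msupp p -> weight w m <= weight w m'.
Proof.
move=> /msupp_nil; elim: (msupp p) => [[m]//|m s IHs] _.
have [->|s0] := eqVneq s [::].
  by exists m; rewrite ?mem_head// => m'; rewrite inE => /eqP ->.
have [|k ks kmin] := IHs.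
  by case: (s) s0 => // a t _; exists a; rewrite mem_head.
have [mk|km] := leP (weight w m) (weight w k).
  exists m; rewrite ?mem_head// => m'; rewrite inE => /predU1P[->//|/kmin].
  exact: le_trans.
exists k; rewrite ?inE ?ks ?orbT// => m' /predU1P[->|/kmin//]; exact: ltW.
Qed.

Lemma initial_formE w p m : m \in msupp p ->
  (forall m', m' \in msupp p -> weight w m <= weight w m') ->
  initial_form w p = level w (weight w m) p.
Proof.
move=> mp mmin; rewrite /initial_form /level /trunc big_seq_cond.
rewrite [RHS]big_seq_cond; apply: eq_bigl => k; apply: andb_id2l => kp.
apply/allP/eqP => [kmin|->//].
by apply/eqP; rewrite eq_le mmin// kmin.
Qed.

Definition graded w I := forall p c, I p -> I (level w c p).

Lemma msupp_ind (I : set S) (P : S -> Prop) : P 0 ->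
  (forall p, p != 0 -> I p ->
    (forall q, I q -> (size (msupp q) < size (msupp p))%N -> P q) -> P p) ->
  forall p, I p -> P p.
Proof.
move=> P0 Prec p Ip; move: {2}(size _).+1 (ltnSn (size (msupp p))) => n.
elim: n => // n IHn in p Ip *; rewrite ltnS => pn.
have [->//|p0] := eqVneq p 0.
by apply: Prec => // q Iq qp; apply: IHn => //; exact: leq_trans qp pn.
Qed.

Lemma lineality_graded w I : lineality I w -> graded w I.
Proof.
move=> Iw; have II : is_ideal I by rewrite -Iw; exact: ideal_gen_ideal.
have I0 : I 0 by case: II.
move=> p c; move: p; apply: msupp_ind => [|p p0 Ip IH].
  by rewrite /level trunc_eq0// => m; rewrite msupp0.
have [m mp mmin] := exists_min w p0.
have Iin : I (initial_form w p).
  rewrite -Iw; apply: sub_gen_smallest; exists p => //; split=> //=.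
  exact/eqP.
have Ein := initial_formE mp mmin; rewrite Ein in Iin.
have := IH _ (is_idealB II Ip Iin) (size_level w mp).
rewrite /level truncB => Ir; rewrite -[trunc _ p](subrK (trunc
  (fun k => weight w k == c) (level w (weight w m) p))).
have [_ ID _] := II; apply: (ID _ _ Ir).
have [mc|mc] := eqVneq (weight w m) c.
  by rewrite trunc_id// => k; rewrite mem_trunc mc => /andP[].
rewrite trunc_eq0// => k; rewrite mem_trunc => /andP[/eqP -> _] //.
Qed.

Lemma graded_lineality w I : is_ideal I -> graded w I -> lineality I w.
Proof.
move=> II Ig; apply/seteqP; split.
  apply: smallest_sub => // _ [p [Ip /= /eqP p0] <-].
  have [m mp mmin] := exists_min w p0.
  by rewrite (initial_formE mp mmin); exact: Ig.
have [G0 GD _] := ideal_gen_ideal [set initial_form w p | p in I `\ 0].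
apply: msupp_ind => // p p0 Ip IH.
have [m mp mmin] := exists_min w p0.
have := IH _ (is_idealB II Ip (Ig _ (weight w m) Ip)) (size_level w mp).
move=> Gr; rewrite -[p](subrK (level w (weight w m) p)); apply: GD => //.
rewrite -(initial_formE mp mmin); apply: sub_gen_smallest.
by exists p => //; split=> //=; exact/eqP.
Qed.

Lemma weightD a w v m : weight (a *: w + v) m = a * weight w m + weight v m.
Proof.
rewrite /weight mulr_sumr -big_split/=; apply: eq_bigr => e _.
by rewrite !ffunE mulrDl -mulrA.
Qed.

Lemma gradedD a w v I : is_ideal I -> graded w I -> graded v I ->
  graded (a *: w + v) I.
Proof.
move=> II Iw Iv p c; move: p; have [I0 ID _] := II.
apply: msupp_ind => [|p p0 Ip IH].
  by rewrite /level trunc_eq0// => m; rewrite msupp0.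
have [m mp] := msupp_nil p0.
pose Q k := (weight v k == weight v m) && (weight w k == weight w m).
have EQ : trunc Q p = level v (weight v m) (level w (weight w m) p).
  by apply/mpolyP=> k; rewrite !mcoeff_trunc /Q; do 2 case: eqP.
have IQ : I (trunc Q p) by rewrite EQ; apply: Iv; exact: Iw.
have Qm : Q m by rewrite /Q !eqxx.
have := IH _ (is_idealB II Ip IQ) (size_trunc mp Qm).
rewrite /level truncB => Ir.
rewrite -[trunc _ p](subrK (trunc
  (fun k => weight (a *: w + v) k == c) (trunc Q p))).
apply: (ID _ _ Ir).
have [mc|mc] := eqVneq (weight (a *: w + v) m) c.
  rewrite trunc_id// => k; rewrite mem_trunc => /andP[/andP[/eqP kv /eqP kw] _].
  by rewrite -mc !weightD kv kw.
rewrite trunc_eq0// => k; rewrite mem_trunc => /andP[/andP[/eqP kv /eqP kw] _].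
by move: mc; rewrite !weightD kv kw.
Qed.

Lemma mem_lineality_space I : is_ideal I ->
  forall w, w \in lineality_space I <-> initial_ideal w I = I.
Proof.
move=> II; have [I0 _ _] := II; apply: vspace_ofP.
  apply: graded_lineality => // p c Ip.
  have w0 m : weight 0 m = 0.
    by rewrite /weight big1// => e _; rewrite ffunE mul0r.
  have [c0|c0] := eqVneq 0 c; rewrite /level.
    by rewrite trunc_id// => m _; rewrite w0 c0.
  by rewrite trunc_eq0// => m _; rewrite w0.
move=> a w v /lineality_graded Iw /lineality_graded Iv.
by apply: graded_lineality => //; exact: gradedD.
Qed.

End Initial.

Section Configurations.
Variables (R : realType) (E : finType).

Definition dual (V : vectType R) := 'Hom(V, R^o).

(* A cell (a_e)_{e in E_f} is represented by its set of labels E_f. *)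
Definition regular_subdivision (w : 'R^(R, E)) (V : vectType R) (a : E -> V) :
    set {set E} :=
  [set D | exists f : dual V,
     D = [set e | [forall e', f (a e) + w e <= f (a e') + w e']]%SET].

Definition point_configuration (I : set (polyring R E)) (e : E) :
    dual (subvs_of (lineality_space I)) :=
  linfun (fun v => (vsval v : 'R^(R, E)) e).

Lemma point_configurationE I e (v : subvs_of (lineality_space I)) :
  point_configuration I e v = (vsval v : 'R^(R, E)) e.
Proof.
pose f (v : subvs_of (lineality_space I)) : R^o := (vsval v : 'R^(R, E)) e.
have flin : linear f by move=> a u1 u2; rewrite /f linearP !ffunE.
pose F := GRing.isLinear.Build _ _ _ _ f flin.
pose g : {linear subvs_of (lineality_space I) -> R^o} := HB.pack f F.
exact: (lfunE g v).
Qed.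

End Configurations.

Section Cells.
Variables (R : realType) (E : finType).
Local Notation S := (polyring R E).

(* rho_D, composed with the inclusion of C[D] in S. *)
Definition cell_restriction (D : {set E}) (p : S) : S :=
  p \mPo [tuple if enum_val i \in D then 'X_i else 0 | i < #|E|].

Definition cell_ideal (I : set S) (D : {set E}) : set S :=
  ideal_gen (cell_restriction D @` I).

Definition subdivision_ideal (I : set S) (w : 'R^(R, E)) : set S :=
  let Theta := regular_subdivision w (point_configuration I) in
  ideal_sum Theta (cell_ideal I).

End Cells.

(* Main.v *)
(* An element f of the dual of L(I)^* is evaluation at some v in L(I), so the cell
   of f consists of the labels minimizing u = v + w.  As I is graded by v, the
   ideal in_u I is contained in in_w I.  If p in I is homogeneous of degree d and
   D is a nonempty cell, the monomials supported on D are those whose u-weight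
   attains the lower bound d * min u, hence rho_D(p) is either 0 or in_u p. *)
Require Import Defs.
From HB Require Import structures.
From mathcomp Require Import all_boot all_order all_algebra.
From mathcomp Require Import boolp classical_sets reals.
From mathcomp Require Import complex mpoly.

Local Open Scope classical_set_scope.
Local Open Scope ring_scope.

Import Order.TTheory GRing.Theory Num.Theory.

(** Finite-dimensional biduality. The coordinate functionals [c i] of a basis span the dual, so [f]
    is determined by the scalars [f (c i)]; these are the coordinates of the required vector. *)
Lemma dual_eval (R : realType) (V : vectType R) (f : dual (dual V)) :
  exists v : V, forall g : dual V, f g = g v.
Proof.
pose b := vbasis (fullv : {vspace V}).
pose c i : dual V := linfun (coord b i : V -> R^o).
exists (\sum_(i < \dim (fullv : {vspace V})) (f (c i) : R) *: b`_i) => g.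
have -> : g = \sum_(i < \dim (fullv : {vspace V})) (g b`_i : R) *: c i.
  apply/lfunP => x; rewrite sum_lfunE {1}(coord_vbasis (memvf x)) linear_sum.
  by apply: eq_bigr => i _; rewrite linearZ scale_lfunE lfunE /=; exact: mulrC.
rewrite linear_sum sum_lfunE; apply: eq_bigr => i _.
by rewrite linearZ scale_lfunE lfunE /= coord_sum_free ?(basis_free (vbasisP _))//.
Qed.

Lemma mem_ideal_sum (A : comNzRingType) (J : set A) (T : eqType) (s : seq T)
    (P : pred T) (F : T -> A) :
  is_ideal J -> (forall i, P i -> J (F i)) -> J (\sum_(i <- s | P i) F i).
Proof. by case=> J0 JD _ JF; apply: big_ind. Qed.

(** A polynomial is the sum of its pieces over the finitely many values of [F] on its support.
    Taking [F] to be a weight or the degree reduces ideal membership to homogeneous pieces. *)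
Lemma ideal_trunc (R : realType) (E : finType) (J : set (polyring R E))
    (T : eqType) (F : 'X_{1..#|E|} -> T) (p : polyring R E) :
  is_ideal J -> (forall c, J (trunc (fun m => F m == c) p)) -> J p.
Proof.
move=> JI Jp.
have -> : p = \sum_(c <- undup (map F (msupp p))) trunc (fun m => F m == c) p.
  apply/mpolyP => m; rewrite raddf_sum /=.
  under eq_bigr => c _ do rewrite mcoeff_trunc.
  have [mp|mp] := boolP (m \in msupp p); last first.
    by rewrite memN_msupp_eq0// big1// => c _; rewrite if_same.
  rewrite (bigD1_seq (F m)) ?undup_uniq ?mem_undup ?map_f//= eqxx.
  by rewrite big1 ?addr0// => c /negbTE cF; rewrite eq_sym cF.
exact: mem_ideal_sum.
Qed.

Lemma initial_form0 (R : realType) (E : finType) (w : 'R^(R, E)) :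
  initial_form w 0 = 0.
Proof. by rewrite /initial_form msupp0 big_nil. Qed.

Lemma initial_ideal_form (R : realType) (E : finType) (w : 'R^(R, E))
    (I : set (polyring R E)) p : I p -> initial_ideal w I (initial_form w p).
Proof.
move=> Ip; have [->|p0] := eqVneq p 0.
  by rewrite initial_form0; have [] := ideal_gen_ideal [set initial_form w p | p in I `\ 0].
by apply: sub_gen_smallest; exists p => //; split=> //=; exact/eqP.
Qed.

(** Within one [v]-level the weights for [v + w] and for [w] differ by a constant. Hence each
    nonzero [v]-level of an initial form for [v + w] is the [w]-initial form of a [v]-level of [p],
    which lies in [I] by gradedness. *)
Lemma initial_idealD (R : realType) (E : finType) (w v : 'R^(R, E))
    (I : set (polyring R E)) :
  graded v I -> initial_ideal (v + w) I `<=` initial_ideal w I.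
Proof.
move=> Iv; apply: smallest_sub; first exact: ideal_gen_ideal.
have wD m : weight (v + w) m = weight v m + weight w m.
  by rewrite -[v]scale1r weightD mul1r scale1r.
move=> _ [p [Ip /= /eqP p0] <-].
have [m0 m0p m0min] := exists_min (v + w) p0.
rewrite (initial_formE m0p m0min).
apply: (@ideal_trunc _ _ _ _ (weight v)) => [|c]; first exact: ideal_gen_ideal.
rewrite -/(level v c _); set q := level v c _.
have [->|/msupp_nil [m]] := eqVneq q 0.
  by have [] := ideal_gen_ideal [set initial_form w p | p in I `\ 0].
rewrite !mem_trunc => /andP[/eqP mc /andP[/eqP mm0 mp]].
suff -> : q = initial_form w (level v c p).
  by apply: initial_ideal_form; exact: Iv.
rewrite (@initial_formE _ _ _ _ m).
- apply/mpolyP => k; rewrite !mcoeff_trunc -mm0 !wD mc.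
  have [->|] := eqVneq (weight v k) c; last by rewrite if_same.
  by rewrite (inj_eq (addrI _)).
- by rewrite mem_trunc mc eqxx.
- move=> k; rewrite mem_trunc => /andP[/eqP kc /m0min].
  by rewrite -mm0 !wD mc kc lerD2l.
Qed.

Definition supported (E : finType) (D : {set E}) (m : 'X_{1..#|E|}) : bool :=
  [forall e, (m (enum_rank e) != 0%N) ==> (e \in D)].

Lemma cell_restrictionE (R : realType) (E : finType) (D : {set E})
    (p : polyring R E) : cell_restriction D p = trunc (supported E D) p.
Proof.
rewrite /cell_restriction comp_mpolyEX /trunc [RHS]big_mkcond /=.
apply: eq_bigr => m _; rewrite comp_mpolyX.
case: ifPn => [/forallP mD|/forallPn[e]].
  congr (_ *: _); rewrite mpolyXE_id; apply: eq_bigr => i _.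
  rewrite tnth_mktuple; have := mD (enum_val i); rewrite enum_valK.
  by have [->|_ /= ->] := eqVneq (m i) 0%N.
(* A variable outside [D] occurs with nonzero exponent, so the substitution kills the monomial. *)
rewrite negb_imply => /andP[me eD].
rewrite (bigD1 (enum_rank e)) //= tnth_mktuple enum_rankK (negbTE eD).
by rewrite expr0n (negbTE me) mul0r scaler0.
Qed.

(** Each variable weighs at least the minimum of [u], with equality exactly on [D]. Summing with
    exponents bounds the weight of [m] below by its degree times that minimum, and [k] attains this
    bound. *)
Lemma weight_supported (R : realType) (E : finType) (u : 'R^(R, E))
    (k m : 'X_{1..#|E|}) :
  let D := [set e | [forall e', u e <= u e']]%SET in
  supported E D k -> mdeg m = mdeg k ->
  weight u k <= weight u m ?= iff supported E D m.
Proof.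
move=> D kD mk.
have degE (n : 'X_{1..#|E|}) : mdeg n = (\sum_e n (enum_rank e))%N.
  rewrite mdegE (reindex enum_rank) //=.
  by exists enum_val => ? _; rewrite (enum_rankK, enum_valK).
(* In degree 0 both monomials are 1; otherwise a variable of [k] provides a label [e0] where [u] is
   minimal. *)
have [k0|] := eqVneq (mdeg k) 0%N.
  have [-> ->] : k = 0%MM /\ m = 0%MM.
    by split; apply/eqP; rewrite -mdeg_eq0 ?mk k0.
  split=> //; rewrite eqxx; apply/esym/forallP => e.
  by rewrite mnm0E eqxx.
rewrite degE sum_nat_eq0 => /forallPn[/= e0 ke0].
have e0D : e0 \in D by have /forallP/(_ e0) := kD; rewrite ke0.
have e0min e : u e0 <= u e by move: e0D; rewrite inE => /forallP.
have DE e : (e \in D) = (u e0 == u e).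
  rewrite inE; apply/forallP/eqP => [emin|<- //].
  by apply/eqP; rewrite eq_le e0min emin.
have -> : weight u k = u e0 * (mdeg m)%:R.
  rewrite mk degE natr_sum mulr_sumr; apply: eq_bigr => e _.
  have /forallP/(_ e) := kD; rewrite DE.
  by have [->|_ /= /eqP ->//] := eqVneq (k (enum_rank e)) 0%N; rewrite !mulr0.
rewrite degE natr_sum mulr_sumr; apply: leif_sum => e _.
rewrite DE; have [->|me] := eqVneq (m (enum_rank e)) 0%N.
  by rewrite !mulr0; exact/leif_refl.
have m0 : 0 < (m (enum_rank e))%:R :> R by rewrite ltr0n lt0n.
by split; rewrite ?ler_pM2r ?(inj_eq (mulIf (lt0r_neq0 m0))).
Qed.

Lemma cell_restriction_initial (R : realType) (E : finType) (u : 'R^(R, E))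
    (I : set (polyring R E)) p :
  homogeneous_ideal I -> I p ->
  initial_ideal u I
    (cell_restriction [set e | [forall e', u e <= u e']]%SET p).
Proof.
move=> Ih Ip; set D := [set _ | _]%SET; rewrite cell_restrictionE.
apply: (@ideal_trunc _ _ _ _ (@mdeg _)) => [|d]; first exact: ideal_gen_ideal.
set q := trunc _ _.
have [->|/msupp_nil [k]] := eqVneq q 0.
  by have [] := ideal_gen_ideal [set initial_form u p | p in I `\ 0].
rewrite !mem_trunc => /andP[/eqP kd /andP[kD kp]].
pose pd : polyring R E := trunc (fun m => mdeg m == d) p.
have wk m : mdeg m = d -> weight u k <= weight u m ?= iff supported E D m.
  by move=> md; apply: weight_supported => //; rewrite md kd.
(* [pd] unfolds to [pihomog mdeg d p], so homogeneity of [I] puts it in [I]. *)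
suff -> : q = initial_form u pd by apply: initial_ideal_form; exact: Ih.
rewrite (@initial_formE _ _ _ _ k).
- apply/mpolyP => m; rewrite !mcoeff_trunc.
  have [md|] := eqVneq (mdeg m) d; last by rewrite if_same.
  by rewrite eq_sym (wk m md).2.
- by rewrite mem_trunc kd eqxx.
- by move=> m; rewrite mem_trunc => /andP[/eqP md _]; exact: (wk m md).1.
Qed.

Theorem theorem3p3 (R : realType) (E : finType) (I : set (polyring R E))
    (w : 'R^(R, E)) :
  is_ideal I ->
  homogeneous_ideal I ->
  ~ (@irrelevant_ideal R E `<=` I) ->
  subdivision_ideal I w `<=` initial_ideal w I.
Proof.
move=> II Ih _ _ [g Jg ->].
apply: mem_ideal_sum => [|D]; first exact: ideal_gen_ideal.
rewrite inE => TD; apply: smallest_sub (Jg _ TD); first exact: ideal_gen_ideal.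
move=> _ [p Ip <-]; case: TD => f DE.
have [x fx] := dual_eval _ _ f.
have Iv : graded (vsval x) I.
  by apply: lineality_graded; apply/(mem_lineality_space II); exact: subvsP.
apply: (initial_idealD _ _ w _ _ Iv).
(* Since [f] is evaluation at [x], its value at the point labelled [e] is the coordinate of [x] at
   [e]. *)
suff -> : D = [set e | [forall e', (vsval x + w) e <= (vsval x + w) e']]%SET.
  exact: cell_restriction_initial.
rewrite DE; apply/setP => e; rewrite !inE; apply: eq_forallb => e'.
by rewrite !fx !point_configurationE !ffunE.
Qed.
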